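(* For $n\ge 0$ let $f_{n,m}$ be the number of forests on $[n]$ with exactly $m$ proper vertices, let $f_n(t)=\sum_{m\ge 0}f_{n,m}t^m$, and let $F=F(x)=\sum_{n\ge 0}f_n(t)\frac{x^n}{n!}$. Then: 1. $F$ satisfies the differential equation $F'=x\,F\,F'+t\,F^2$ with $F(0)=1$, where the prime denotes the derivative with respect to $x$. 2. $F$ satisfies the functional equation $F=\big(1+(t-1)\,x\,F\big)^{t/(t-1)}$. 3. For $n\ge 1$, $$f_n(t)=t\,\prod_{i=1}^{n-1}\big((i+1)\,t+(n-i)\big).$$
   Context: $[n]=\{1,\dots,n\}$. A tree is a labeled rooted tree (an acyclic connected graph with a distinguished root vertex). A forest on $[n]$ is a graph with vertex set $[n]$ each of whose connected components is a rooted tree (for $n=0$ there is exactly one, the empty forest, with $0$ proper vertices). A vertex $j$ is a descendant of $i$ if $i$ lies on the path from $j$ to the root of the component containing $j$ (so $i$ is a descendant of itself). A vertex $i$ is proper if $i$ is the smallest among all its descendants. Here $t$ is an indeterminate and identities are between formal power series in $x$ with coefficients in $\mathbb Q(t)$; for a power series $u$ with zero constant term, $(1+u)^c=\sum_{j\ge 0}\binom{c}{j}u^j$. *)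

(* Defs.v *)
From mathcomp Require Import all_boot all_order all_algebra.

Set Implicit Arguments.
Unset Strict Implicit.
Unset Printing Implicit Defensive.

Import GRing.Theory.
Local Open Scope ring_scope.

(** Rooted forests.  The label k+1 in {1, ..., n} is represented by k : 'I_n,
    which preserves the order of the labels. *)

Section Forests.
Variable n : nat.

(* A simple graph is given by its set of edges, an edge being a pair of
   distinct vertices. *)
Definition simple_graph (E : {set {set 'I_n}}) : bool :=
  [forall a in E, #|a| == 2%N].

Definition adj (E : {set {set 'I_n}}) : rel 'I_n := fun i j => [set i; j] \in E.

(* A cycle of a graph visits k >= 3 vertices, all distinct, hence k <= n. *)
Definition acyclic (E : {set {set 'I_n}}) : bool :=
  [forall k : 'I_n.+1, forall c : k.-tuple 'I_n,
    (2 < k)%N ==> ~~ (cycle (adj E) c && uniq c)].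

(* A rooted forest is a pair (edge set, root set). *)
Local Notation rooted_graph := ({set {set 'I_n}} * {set 'I_n})%type.

Definition is_forest (G : rooted_graph) : bool :=
  [&& simple_graph G.1, acyclic G.1 &
      [forall i : 'I_n, #|[set r in G.2 | connect (adj G.1) i r]| == 1%N]].

(* The simple path j :: p runs from j to a root and meets i.  In a forest there
   is exactly one simple path from j to a root, so "some path" is "the path". *)
Definition descendant (G : rooted_graph) (i j : 'I_n) : bool :=
  [exists k : 'I_n, exists p : k.-tuple 'I_n,
    [&& path (adj G.1) j p, uniq (j :: p), last j p \in G.2 & i \in j :: p]].

Definition proper_vertex (G : rooted_graph) (i : 'I_n) : bool :=
  [forall j : 'I_n, descendant G i j ==> (i <= j)%N].

Definition forest_count (m : nat) : nat :=
  #|[set G : rooted_graph |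
      is_forest G & #|[set i | proper_vertex G i]| == m]|.

(* The truncation at degree n is harmless: see coef_forest_poly. *)
Definition forest_poly : {poly rat} := \poly_(m < n.+1) (forest_count m)%:R.

Lemma coef_forest_poly m : forest_poly`_m = (forest_count m)%:R.
Proof.
rewrite coef_poly ltnS; case: leqP => // lt_nm.
rewrite /forest_count (_ : [set _ | _ & _] = set0) ?cards0 //.
apply/setP=> G; rewrite !inE; apply/negP=> /andP[_ /eqP eq_m].
by have := max_card [set i | proper_vertex G i]; rewrite card_ord eq_m leqNgt lt_nm.
Qed.

End Forests.

(** Formal power series over a field, as coefficient sequences; their equality
    is pointwise equality =1. *)

Section PowerSeries.
Variable K : fieldType.
Implicit Types (a b u : nat -> K) (c : K).

Definition fps_one : nat -> K := fun n => (n == 0%N)%:R.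
Definition fps_X : nat -> K := fun n => (n == 1%N)%:R.
Definition fps_add a b : nat -> K := fun n => a n + b n.
Definition fps_scale c a : nat -> K := fun n => c * a n.
Definition fps_mul a b : nat -> K := fun n => \sum_(i < n.+1) a i * b (n - i)%N.
Definition fps_pow a (j : nat) : nat -> K := iter j (fps_mul a) fps_one.
Definition fps_deriv a : nat -> K := fun n => n.+1%:R * a n.+1.

Definition gbinom c (j : nat) : K := (\prod_(i < j) (c - i%:R)) / j`!%:R.

(* (1 + u)^c, the sum over j of gbinom c j * u^j, meaningful only when
   u 0 = 0: then u^j has no coefficient of degree n < j (fps_pow_lt). *)
Definition fps_binpow u c : nat -> K :=
  fun n => \sum_(j < n.+1) gbinom c j * fps_pow u j n.

Lemma fps_pow_lt u j n : u 0%N = 0 -> (n < j)%N -> fps_pow u j n = 0.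
Proof.
move=> u0; elim: j n => // j IHj n lt_nj; rewrite /fps_pow iterS.
apply: big1 => -[[|i] /= lt_in] _; first by rewrite u0 mul0r.
rewrite [iter j _ _ _]IHj ?mulr0 //.
by case: n lt_nj lt_in => // n lt_nj _; rewrite subSS (leq_ltn_trans (leq_subr i n)).
Qed.

End PowerSeries.

Arguments fps_one {K}.
Arguments fps_X {K}.

Notation Qt := {fraction {poly rat}}.

Definition tvar : Qt := tofrac 'X.

Definition forest_series : nat -> Qt :=
  fun n => tofrac (forest_poly n) / n`!%:R.

(* Main.v *)
Require Import Defs.
From mathcomp Require Import all_boot all_order all_algebra.
From mathcomp Require Import ring.

(** Write f_n(t) for the generating polynomial of the rooted forests on n
    ordered vertices by their number of proper vertices.  Everything rests on
    the quadratic recurrence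
      2 f_(n+1) = (2 t + n) sum_k C(n, k) f_k f_(n-k).

    It comes from cutting a forest at the root v of the tree that contains the
    smallest vertex m.  The strict descendants D of v and the remaining
    vertices R carry two arbitrary forests, except that m must lie in D or be
    v, and all the vertices of D and R keep their sets of descendants.  The
    vertex v has m among its descendants, so it is proper exactly when v = m
    (forest_weight_rec).  If v = m, then D is any subset of the other n
    vertices, whence the term in 2 t.  For each of the n other v, the
    condition that m lies in D selects one of D and R for each unordered pair
    {D, R}, whence one half of the unrestricted sum (sum_subsets_half).  The
    argument is made with parent functions, which correspond to forests given by edges and
    roots (parent_graph_forest, parent_graph_inj, parent_graph_surj).

    The polynomials r * prod_(0 < j < n) (r + n z - j e) are of binomial type
    in r (rothe_convolution).  For z = t and e = t - 1 the claimed product is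
    the value at r = t, its binomial convolution square is the value at
    r = 2 t, and these two satisfy the recurrence because the product for
    n + 1 has exactly one more factor, 2 t + n.  Hence f_n is the product
    (forest_polyE).

    For the exponential generating series F, the recurrence is the
    differential equation F' = x F F' + t F^2, since 2 F F' = (F^2)'.  With
    u = (t - 1) x F and c = t / (t - 1), that equation can be rewritten as
    (1 + u) F' = c F u'.  The series (1 + u)^c solves the same linear equation
    with the same constant term, and such a solution is unique
    (linear_ode_uniq). *)

Set Implicit Arguments.
Unset Strict Implicit.
Unset Printing Implicit Defensive.

Import GRing.Theory.
Local Open Scope ring_scope.

(** * A sequence of polynomials of binomial type *)

Section BinomialType.
Variable R : idomainType.
Hypothesis char0 : forall k : nat, k.+1%:R != 0 :> R.
Variables e z : R.
Hypothesis e_neq0 : e != 0.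

(** Up to the factor n`!, the coefficients of B^r for the series B defined by
    B = (1 + e x B^z)^(1/e); for e = 1 they give the Rothe-Hagen identity. *)
Definition rothe (n : nat) (r : R) : R :=
  if n is n'.+1 then r * \prod_(1 <= j < n) (r + n%:R * z - j%:R * e) else 1.

Definition rothe_poly (n : nat) : {poly R} :=
  if n is n'.+1 then
    'X * \prod_(1 <= j < n) ('X + (n%:R * z - j%:R * e)%:P) else 1.

Lemma horner_rothe_poly n r : (rothe_poly n).[r] = rothe n r.
Proof.
case: n => [|n] /=; first by rewrite hornerE.
rewrite hornerM hornerX horner_prod; congr (_ * _).
by apply: eq_bigr => j _; rewrite hornerD hornerX hornerC addrA.
Qed.

(** The coefficientwise form of B^r - B^(r-e) = e x B^(r+z-e). *)
Lemma rothe_diff n r :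
  rothe n.+1 r - rothe n.+1 (r - e) = n.+1%:R * e * rothe n (r + z - e).
Proof.
case: n => [|n]; first by rewrite /rothe !big_geq //; ring.
rewrite /rothe big_nat_recl // [in X in _ - X]big_nat_recr //=.
set P := \prod_(1 <= j < n.+1) (r + z - e + n.+1%:R * z - j%:R * e).
rewrite (_ : \prod_(1 <= j < n.+1) (r + n.+2%:R * z - j.+1%:R * e) = P); last first.
  by apply: eq_bigr => j _; ring.
rewrite (_ : \prod_(1 <= j < n.+1) (r - e + n.+2%:R * z - j%:R * e) = P); last first.
  by apply: eq_bigr => j _; ring.
ring.
Qed.

Lemma sum_binS (a b : nat -> R) n :
  \sum_(k < n.+2) 'C(n.+1, k)%:R * (k%:R * a k.-1 * b (n.+1 - k)%N) =
  n.+1%:R * \sum_(k < n.+1) 'C(n, k)%:R * (a k * b (n - k)%N).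
Proof.
rewrite big_ord_recl /= !mul0r mulr0 add0r mulr_sumr.
apply: eq_bigr => k _; rewrite /bump /= add1n subSS.
have := mul_bin_diag n.+1 k; move/(congr1 (fun m => m%:R : R)).
rewrite !natrM => E; rewrite !mulrA E; ring.
Qed.

(** In characteristic zero the multiples of e are infinitely many roots. *)
Lemma periodic_poly0 (p : {poly R}) :
  (forall r, p.[r] = p.[r - e]) -> p.[0] = 0 -> p = 0.
Proof.
move=> per p0; apply/eqP; apply: contraT => pn0.
have rts k : root p (- (k%:R * e)).
  elim: k => [|k]; first by rewrite mul0r oppr0 rootE p0.
  by rewrite !rootE per (_ : - (k%:R * e) - e = - (k.+1%:R * e)) //; ring.
have := max_poly_roots (rs := [seq - (k%:R * e) | k <- iota 0 (size p)]) pn0.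
rewrite size_map size_iota ltnn => -> //; first by apply/allP => _ /mapP[k _ ->].
rewrite map_inj_in_uniq ?iota_uniq //.
have nat_inj (i k : nat) : (i < k)%N -> i%:R <> k%:R :> R.
  move=> ltik /esym/eqP; rewrite -subr_eq0 -natrB 1?ltnW //.
  by rewrite -(ltn_predK (n := (k - i)%N) (m := 0)) ?subn_gt0 // (negPf (char0 _)).
move=> i j _ _ /oppr_inj /(mulIf e_neq0) Eij.
by case: (ltngtP i j) => // [/nat_inj|/nat_inj/nesym].
Qed.

(** For fixed s, the difference of the two sides is a polynomial in r.  Its
    increments over a step e vanish by induction, since rothe_diff turns both
    sides for n.+1 into the identity for n. *)
Theorem rothe_convolution n r s :
  \sum_(k < n.+1) 'C(n, k)%:R * (rothe k r * rothe (n - k) s) = rothe n (r + s).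
Proof.
elim: n r => [|n IHn] r; first by rewrite big_ord1 bin0 !mulr1.
pose p := \sum_(k < n.+2) ('C(n.+1, k)%:R * rothe (n.+1 - k) s)%:P * rothe_poly k
          - (rothe_poly n.+1 \Po ('X + s%:P)).
have pE x : p.[x] = \sum_(k < n.+2) 'C(n.+1, k)%:R * (rothe k x * rothe (n.+1 - k) s)
                    - rothe n.+1 (x + s).
  rewrite /p hornerD hornerN horner_comp horner_rothe_poly hornerD hornerX hornerC horner_sum.
  by congr (_ - _); apply: eq_bigr => k _; rewrite hornerM hornerC horner_rothe_poly; ring.
suff p0 : p = 0 by apply/eqP; rewrite -subr_eq0 -pE p0 horner0.
apply: periodic_poly0 => [x|]; last first.
  (* rothe k 0 = 0 unless k = 0 *)
  rewrite pE add0r big_ord_recl bin0 big1 ?subn0; first by rewrite /=; ring.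
  by move=> k _; rewrite /= mul0r mul0r mulr0.
apply/eqP; rewrite -subr_eq0 !pE.
have sub4 (a b c d : R) : a - b - (c - d) = (a - c) - (b - d) by ring.
rewrite sub4 -sumrB [x - e + s]addrAC.
rewrite rothe_diff.
under eq_bigr => k _.
  rewrite -mulrBr -mulrBl (_ : _ - _ = e * (k%:R * rothe k.-1 (x + z - e))); last first.
    by case: (k : nat) => [|k']; [rewrite /=; ring | rewrite rothe_diff; ring].
  rewrite -mulrA mulrCA.
  over.
rewrite -mulr_sumr (sum_binS (fun k => rothe k (x + z - e)) (fun k => rothe k s)) IHn.
by rewrite (_ : x + z - e + s = x + s + z - e); [apply/eqP|]; ring.
Qed.
End BinomialType.

(** * The product formula satisfies the quadratic recurrence *)

Definition product_poly (n : nat) : {poly rat} :=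
  if n is 0 then 1
  else 'X * \prod_(1 <= i < n) ((i + 1)%N%:R * 'X + (n - i)%N%:R).

Lemma product_poly_rothe n : product_poly n = rothe ('X - 1) 'X n 'X.
Proof.
case: n => // n; rewrite /rothe /product_poly big_nat_rev /=; congr (_ * _).
apply: eq_big_nat => i /andP[i1 i2]; rewrite add1n subSS subKn 1?ltnW //.
by rewrite addn1 -addn1 natrD natrB 1?ltnW //; ring.
Qed.

Lemma natpoly_neq0 k : k.+1%:R != 0 :> {poly rat}.
Proof. by rewrite -polyC_natr polyC_eq0 Num.Theory.pnatr_eq0. Qed.

(** Convolution gives rothe n at 2 t, which lacks only the factor 2 t + n of
    the product for n.+1. *)
Lemma product_poly_rec n :
  2%:R * product_poly n.+1 =
  (2%:R * 'X + n%:R) *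
    \sum_(k < n.+1) 'C(n, k)%:R * (product_poly k * product_poly (n - k)).
Proof.
under eq_bigr do rewrite !product_poly_rothe.
rewrite rothe_convolution ?polyXsubC_eq0 ?natpoly_neq0 //; last first.
- exact: natpoly_neq0.
rewrite product_poly_rothe; case: n => [|n]; first by rewrite /rothe !big_geq //; ring.
rewrite /rothe big_nat_recr //=.
rewrite [X in _ * (_ * (X * _))](eq_bigr (fun j => 'X + 'X + n.+1%:R * 'X - j%:R * ('X - 1))).
  by rewrite -[n.+2]addn1 !natrD; ring.
by move=> j _; rewrite -[n.+2]addn1 !natrD; ring.
Qed.

(** * Rooted forests as parent functions *)

Section ParentFunctions.
Variable N : nat.
Local Notation T := 'I_N.
Implicit Types (f g : {ffun T -> option T}) (x y i j : T).

Definition parent f : rel T := fun x y => f x == Some y.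

(** Acyclicity as a boolean, so that it can restrict finite sums; proofs use
    the rank functions of acyclic_rankP. *)
Definition acyclic_parent f : bool :=
  [forall x, forall y, parent f x y ==> ~~ connect (parent f) y x].

(** The number of ancestors is a rank. *)
Lemma acyclic_rankP f :
  reflect (exists d : T -> nat, forall x y, parent f x y -> (d y < d x)%N)
          (acyclic_parent f).
Proof.
apply: (iffP forallP) => [acf | [d dP] x].
  exists (fun x => #|[set y | connect (parent f) x y]|) => x y fxy.
  apply/proper_card/properP; split.
    by apply/subsetP=> k; rewrite !inE; apply/connect_trans/connect1.
  exists x; rewrite !inE ?connect0 //.
  by have /forallP/(_ y)/implyP/(_ fxy) := acf x.
apply/forallP=> y; apply/implyP=> /dP lt_yx; apply/negP=> /connectP[p].
move=> pP Ex; have: (d x <= d y)%N; last by rewrite leqNgt lt_yx.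
elim: p y {lt_yx} pP Ex => [|k p IHp] y /=; first by move=> _ ->.
by case/andP=> /dP/ltnW le_ky pP /(IHp _ pP)/leq_trans->.
Qed.

Lemma connect_parent_None f x y : f x = None -> connect (parent f) x y -> x = y.
Proof. by move=> fx /connectP[[|k p] //=]; rewrite /parent fx. Qed.

Lemma connect_root_uniq f x r r' : f r = None -> f r' = None ->
  connect (parent f) x r -> connect (parent f) x r' -> r = r'.
Proof.
move=> fr fr' /connectP[p]; elim: p x => [|y p IHp] x /=.
  by move=> _ <- /(connect_parent_None fr).
case/andP=> /eqP fxy pP Er /connectP[[|k q] /=].
  by move=> _ E; rewrite -E fr' in fxy.
rewrite {1}/parent fxy => /andP[/eqP[<-] qP Er'].
by apply: IHp pP Er _; apply/connectP; exists q.
Qed.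

Lemma has_root f x : acyclic_parent f ->
  exists2 r, f r = None & connect (parent f) x r.
Proof.
case/acyclic_rankP=> d dP.
have [n] := ubnP (d x); elim: n x => // n IHn x lt_dn.
case E: (f x) => [y|]; last by exists x; rewrite ?connect0.
have fxy : parent f x y by apply/eqP.
have [|r fr yr] := IHn y; first by rewrite (leq_trans (dP _ _ fxy)).
by exists r => //; apply: connect_trans yr; apply: connect1.
Qed.

Definition parent_graph f : {set {set T}} * {set T} :=
  ([set [set x; y] | x in T, y in T & parent f x y], [set x | f x == None]).

Lemma adj_sym (E : {set {set T}}) x y : adj E x y = adj E y x.
Proof. by rewrite /adj setUC. Qed.

Lemma adj_parent_graph f x y :
  adj (parent_graph f).1 x y = parent f x y || parent f y x.
Proof.
apply/imset2P/orP => [[a b _ /=]|].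
  rewrite inE /= => fab E.
  have xab : x \in [set a; b] by rewrite -E set21.
  have yab : y \in [set a; b] by rewrite -E set22.
  have axy : a \in [set x; y] by rewrite E set21.
  have bxy : b \in [set x; y] by rewrite E set22.
  case/set2P: xab => Ex; case/set2P: yab => Ey; subst x y; auto.
  - by move: bxy; rewrite !inE orbb => /eqP Eb; subst b; left.
  - by move: axy; rewrite !inE orbb => /eqP Ea; subst a; left.
by case=> fxy; [exists x y | exists y x]; rewrite ?inE // setUC.
Qed.

(** A vertex of maximal rank on a cycle would have both of its neighbours as
    parent. *)
Lemma acyclic_parent_graph f : acyclic_parent f -> acyclic (parent_graph f).1.
Proof.
case/acyclic_rankP=> d dP; apply/forallP=> k; apply/forallP=> c; apply/implyP=> k2.
apply/negP=> /andP[cyc Uc].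
have [x0 x0c] : exists x, x \in val c.
  by case: c k2 {cyc Uc} => -[|x s] /= /eqP<- // _; exists x; rewrite mem_head.
have [x xc xmax] := arg_maxnP (fun x => d x) x0c.
have up y : y \in val c -> adj (parent_graph f).1 x y -> f x = Some y.
  move=> yc; rewrite adj_parent_graph => /orP[/eqP //|/dP].
  by rewrite ltnNge (xmax y yc : (d y <= d x)%N).
have [i q Eq] := rot_to (xc : x \in val c).
move: cyc Uc; rewrite -(rot_cycle i) -(rot_uniq i) Eq.
have: size (rot i c) = k by rewrite size_rot size_tuple.
have mem_c y : y \in x :: q -> y \in val c by rewrite -Eq mem_rot.
rewrite Eq; case: q {Eq} mem_c => [|a [|b q]] mem_c /= Ek; try by rewrite -Ek in k2.
rewrite rcons_path => /and3P[xa _ /andP[_ lx]] /and3P[_ + _].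
have ac : a \in val c by apply: mem_c; rewrite !inE eqxx orbT.
have lc : last b q \in val c.
  by apply: mem_c; rewrite [_ \in x :: _]inE [_ \in a :: _]inE mem_last !orbT.
have := up _ lc; rewrite adj_sym (up _ ac xa) => /(_ lx)[->].
by rewrite mem_last.
Qed.

Lemma connect_parent_graph f x y :
  connect (parent f) x y -> connect (adj (parent_graph f).1) x y.
Proof.
by apply: connect_sub => a b ab; apply: connect1; rewrite adj_parent_graph ab.
Qed.

(** Walking along an edge in either direction does not change the root. *)
Lemma connect_graph_root f x y r : connect (adj (parent_graph f).1) x y ->
  f r = None -> connect (parent f) x r = connect (parent f) y r.
Proof.
move=> /connectP[p + ->] fr; elim: p x => //= z p IHp x /andP[xz /IHp <-].
have one a b : parent f a b -> connect (parent f) a r = connect (parent f) b r.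
  move=> ab; apply/idP/idP; last exact/connect_trans/connect1.
  case/connectP=> -[|c q] /=; first by move=> _ E; move: ab; rewrite /parent -E fr.
  case/andP=> /eqP ac qP ->; move: ab; rewrite /parent ac => /eqP[<-].
  by apply/connectP; exists q.
by move: xz; rewrite adj_parent_graph => /orP[/one|/one->].
Qed.

Lemma parent_graph_forest f : acyclic_parent f -> is_forest (parent_graph f).
Proof.
move=> acf; apply/and3P; split; last 1 first.
- apply/forallP=> x; have [r fr xr] := has_root x acf.
  apply/eqP/eqP/cards1P; exists r; apply/setP=> r'; rewrite !inE.
  apply/andP/eqP=> [[/eqP fr' xr'] | ->]; last by rewrite fr connect_parent_graph.
  apply: (connect_root_uniq fr' fr _ xr).
  by rewrite (connect_graph_root xr').
- apply/forall_inP=> ? /imset2P[x y _]; rewrite inE /= => xy ->.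
  rewrite cards2; case: (x =P y) xy => // ->.
  by case/acyclic_rankP: acf => d dP /dP; rewrite ltnn.
exact: acyclic_parent_graph.
Qed.

(** By induction on the rank of x: the edge from x to its parent y under f is
    oriented the same way by g, for otherwise x would be the parent of y under
    g, hence under f, against the ranks. *)
Lemma parent_graph_inj : {in acyclic_parent &, injective parent_graph}.
Proof.
move=> f g acf acg E; apply/ffunP.
have Er x : (f x == None) = (g x == None).
  by move/(congr1 snd)/setP/(_ x): E; rewrite !inE.
have Ee x y : parent f x y || parent f y x = parent g x y || parent g y x.
  by rewrite -!adj_parent_graph E.
case/acyclic_rankP: acf => d dP x.
have [n] := ubnP (d x); elim: n x => // n IHn x lt_dn.
case Ex: (f x) (Er x) => [y|]; last by move/esym/eqP->.
have fxy : parent f x y by apply/eqP.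
have := Ee x y; rewrite fxy /= => /esym/orP[/eqP-> //|].
rewrite /parent -IHn; last exact: leq_trans (dP _ _ fxy) _.
by move/dP; rewrite ltnNge ltnW // dP.
Qed.

(** A simple path that once steps from a vertex x down to a child y can only
    go on downwards. *)
Lemma no_root_below f x y p : parent f y x -> path (adj (parent_graph f).1) y p ->
  x \notin y :: p -> uniq (y :: p) -> f (last y p) <> None.
Proof.
elim: p x y => [|z p IHp] x y; first by move=> /eqP /= ->.
move=> yx /= /andP[yz pP]; rewrite !inE !negb_or => /and3P[_ xz xp].
case/and3P=> /andP[nyz yp] zp Up.
apply: (IHp y z) => //=; last 2 first.
- by rewrite inE negb_or nyz.
- by rewrite zp.
move: yz; rewrite adj_parent_graph => /orP[yz|//].
by move: yx xz; rewrite /parent (eqP yz) => /eqP[->]; rewrite eqxx.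
Qed.

(** Hence a simple path of the graph that ends in a root follows the parents. *)
Lemma path_to_root f y p : path (adj (parent_graph f).1) y p -> uniq (y :: p) ->
  f (last y p) = None -> path (parent f) y p.
Proof.
elim: p y => //= z p IHp y /andP[yz pP] /and3P[yzp zp Up] fl.
rewrite IHp //= ?zp // andbT; move: yz; rewrite adj_parent_graph => /orP[//|zy].
by case: (no_root_below zy pP yzp _ fl); rewrite /= zp.
Qed.

Lemma connect_path_prefix (e : rel T) x p y : path e x p -> y \in x :: p -> connect e x y.
Proof.
elim: p x => [|z p IHp] x /=; first by rewrite inE => _ /eqP->.
case/andP=> xz pP; rewrite inE => /orP[/eqP->//|/(IHp z pP)].
exact/connect_trans/connect1.
Qed.

Lemma descendant_parent_graph f i j : acyclic_parent f ->
  descendant (parent_graph f) i j = connect (parent f) j i.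
Proof.
move=> acf; apply/existsP/idP=> [[k /existsP[p /and4P[pP Up]]]|].
  rewrite inE => /eqP fl; apply: connect_path_prefix.
  exact: path_to_root.
move=> ji; have [r fr] := has_root i acf.
case/connectP: ji => p pP Ei; case/connectP=> q qP Er.
have pqP : path (parent f) j (p ++ q) by rewrite cat_path pP -Ei.
have Upq : uniq (j :: p ++ q).
  case/acyclic_rankP: acf => d dP.
  (* the rank decreases along the path, so its vertices are distinct *)
  have : sorted (fun x y => d y < d x)%N (j :: p ++ q) by apply: sub_path pqP.
  apply: sorted_uniq; last by move=> x; rewrite ltnn.
  by move=> a b c ba ac; apply: ltn_trans ac ba.
have lt_N : (size (p ++ q) < N)%N.
  by have := max_card (mem (j :: p ++ q)); rewrite card_ord (card_uniqP Upq).
exists (Ordinal lt_N); apply/existsP; exists (in_tuple (p ++ q)); rewrite Upq /=.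
rewrite last_cat -Ei -Er inE fr eqxx -cat_cons mem_cat Ei mem_last /= !andbT.
by apply: sub_path pqP => a b ab; rewrite adj_parent_graph ab.
Qed.

(** The parent of x is a neighbour of x one step closer to the roots.  An edge
    that were not of this kind would close a cycle with the paths that lead
    from its ends to their common root. *)
Lemma parent_graph_surj (G : {set {set T}} * {set T}) : is_forest G ->
  exists2 f, acyclic_parent f & parent_graph f = G.
Proof.
case: G => E R /and3P[/= /forall_inP simpE acE /forallP rootE].
pose dist_le n x := [exists p : n.-tuple T, path (adj E) x p && (last x p \in R)].
have ex_dist x : exists n, dist_le n x.
  have /cards1P[r] := rootE x => /setP/(_ r); rewrite !inE eqxx => /andP[rR].
  case/connectP=> p pP Er; exists (size p); apply/existsP; exists (in_tuple p).
  by rewrite pP -Er.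
pose dist x := ex_minn (ex_dist x).
have dist0 x : (dist x == 0)%N = (x \in R).
  rewrite /dist; case: ex_minnP => m /existsP[p /andP[pP pR]] min_m.
  apply/eqP/idP => [m0 | xR]; first by move: p pP pR; rewrite m0 => p; rewrite tuple0.
  apply/eqP; rewrite -leqn0 min_m //; apply/existsP; exists [tuple] => //=.
have distS x : x \notin R -> exists y, adj E x y && (dist y < dist x)%N.
  rewrite -dist0 {1 3}/dist; case: ex_minnP => -[//|m] /existsP[p /andP[pP pR]] min_m _.
  case/tupleP: p pP pR => y p /= /andP[xy pP] pR; exists y; rewrite xy ltnS /=.
  rewrite /dist; case: ex_minnP => k _; apply; apply/existsP; exists p.
  by rewrite pP.
pose f := [ffun x => if x \in R then None else [pick y | adj E x y && (dist y < dist x)%N]].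
have fP x y : parent f x y -> adj E x y && (dist y < dist x)%N.
  rewrite /parent ffunE; case: ifP => // _; case: pickP => // z zP /eqP[<-].
  exact: zP.
have fR x : (f x == None) = (x \in R).
  rewrite ffunE; case: ifP => // /negbT/distS[y yP].
  by case: pickP => // /(_ y); rewrite yP.
have acf : acyclic_parent f.
  by apply/acyclic_rankP; exists dist => x y /fP/andP[].
have sub x y : adj (parent_graph f).1 x y -> adj E x y.
  rewrite adj_parent_graph => /orP[/fP/andP[]//|/fP/andP[]].
  by rewrite adj_sym.
have eqR : (parent_graph f).2 = R by apply/setP=> x; rewrite inE fR.
exists f => //; rewrite [LHS]surjective_pairing eqR; congr (_, _).
have eq_adj x y : adj E x y -> adj (parent_graph f).1 x y.
  move=> xy; apply: contraT => nxy.
  have neq_xy : x != y.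
    by have := simpE _ xy; rewrite cards2; case: (x == y).
  have [r fr xr] := has_root x acf; have [r' fr' yr] := has_root y acf.
  have subc a b : connect (adj (parent_graph f).1) a b -> connect (adj E) a b.
    by apply: connect_sub => c d /sub/connect1.
  have Er : r' = r.
    have /cards1P[s /setP Es] := rootE x.
    have := Es r; have := Es r'; rewrite !inE -!fR fr fr' !eqxx /=.
    rewrite (subc _ _ (connect_parent_graph xr)).
    rewrite (connect_trans (connect1 xy) (subc _ _ (connect_parent_graph yr))).
    by move=> /esym/eqP -> /esym/eqP ->.
  have symf : connect_sym (adj (parent_graph f).1).
    by apply: sym_connect_sym => a b; apply: adj_sym.
  (* xy is not an edge of the parent graph, so a simple path from x to y in
     that graph has length at least 2 and closes up to a cycle with xy *)
  have : connect (adj (parent_graph f).1) x y.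
    apply: (connect_trans (connect_parent_graph xr)); rewrite symf -Er.
    exact: connect_parent_graph.
  case/connectP=> p0 p0P Ey0; case: (shortenP p0P) Ey0 => p pP Up _ Ey.
  have sz : (2 < (size p).+1)%N.
    case: p pP Ey {Up} => [_ Ey|z [|//] /=]; first by rewrite Ey eqxx in neq_xy.
    by rewrite andbT => xz Ey; rewrite Ey xz in nxy.
  have szN : ((size p).+1 < N.+1)%N.
    by have := max_card (mem (x :: p)); rewrite card_ord (card_uniqP Up).
  move: acE => /forallP/(_ (Ordinal szN))/forallP/(_ (in_tuple (x :: p))).
  move/implyP/(_ sz)/negP; case; apply/andP; split; last exact: Up.
  by rewrite /= rcons_path (sub_path sub pP) -Ey adj_sym.
apply/setP=> a; apply/idP/idP => aE.
  case/imset2P: aE => x y _; rewrite inE /= => /fP/andP[xy _] ->.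
  exact: xy.
have := simpE a aE => /cards2P[x [y [_ Ea]]]; rewrite Ea.
by apply: eq_adj; rewrite /adj -Ea.
Qed.

(** * The generating polynomial as a sum over parent functions *)

Definition min_proper f i : bool :=
  [forall j, connect (parent f) j i ==> (i <= j)%N].

Lemma proper_vertex_parent_graph f : acyclic_parent f ->
  proper_vertex (parent_graph f) =1 min_proper f.
Proof.
by move=> acf i; apply: eq_forallb => j; rewrite descendant_parent_graph.
Qed.

Lemma sum_forests (V : nmodType) (F : {set {set T}} * {set T} -> V) :
  \sum_(G | is_forest G) F G = \sum_(f | acyclic_parent f) F (parent_graph f).
Proof.
pose D := [set f : {ffun T -> option T} | acyclic_parent f].
rewrite (eq_bigl (mem (parent_graph @: D))); last first.
  move=> G; apply/idP/imsetP => [/parent_graph_surj[f acf <-]|[f]].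
    by exists f; rewrite ?inE.
  by rewrite inE => /parent_graph_forest ? ->.
rewrite big_imset /=; first by apply: eq_bigl => f; rewrite inE.
by move=> f g; rewrite !inE; apply: parent_graph_inj.
Qed.

Lemma forest_poly_sum_parent :
  forest_poly N = \sum_(f : {ffun T -> option T} | acyclic_parent f)
                    'X^#|[set i | min_proper f i]|.
Proof.
transitivity (\sum_(G : {set {set T}} * {set T} | is_forest G)
                'X^#|[set i | proper_vertex G i]| : {poly rat}); last first.
  rewrite sum_forests; apply: eq_bigr => f acf; congr ('X^ _).
  by apply: eq_card => i; rewrite !inE proper_vertex_parent_graph.
apply/polyP=> m; rewrite coef_forest_poly coef_sum /forest_count -sum1_card natr_sum.
rewrite (eq_bigl (fun G => is_forest G && (#|[set i | proper_vertex G i]| == m))).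
  by rewrite big_mkcondr; apply: eq_bigr => G _; rewrite coefXn eq_sym; case: eqP.
by move=> G; rewrite inE.
Qed.

End ParentFunctions.

(** * Cutting a forest at the root above the smallest vertex *)

Section Recursion.
Variable N : nat.
Local Notation T := 'I_N.
Implicit Types (f g h : {ffun T -> option T}) (x y i j v : T) (S D A : {set T}).

(** Vertices outside S are kept as isolated roots, so that the forests on all
    the subsets S live in one type and no relabelling is needed. *)
Definition forest_on S f : bool :=
  acyclic_parent f &&
  [forall x, if x \in S then (if f x is Some y then y \in S else true)
             else f x == None].

Definition forest_weight S : {poly rat} :=
  \sum_(f | forest_on S f) 'X^#|[set i in S | min_proper f i]|.

Lemma forest_on_in S f x y : forest_on S f -> f x = Some y -> (x \in S) && (y \in S).
Proof. by case/andP=> _ /forallP/(_ x); case: ifP => _ + fx; rewrite fx. Qed.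

Lemma forest_on_out S f x : forest_on S f -> x \notin S -> f x = None.
Proof.
move=> fS; apply: contraNeq; case E: (f x) => [y|] // _.
by case/andP: (forest_on_in fS E).
Qed.

Definition prune A f : {ffun T -> option T} :=
  [ffun x => if x \in A then obind (fun y => if y \in A then Some y else None) (f x)
             else None].

Lemma prune_forest A f : acyclic_parent f -> forest_on A (prune A f).
Proof.
case/acyclic_rankP=> d dP; apply/andP; split.
  apply/acyclic_rankP; exists d => x y; rewrite /parent ffunE.
  case: ifP => // _; case E: (f x) => [z|] //=; case: ifP => // _ /eqP[<-].
  by apply: dP; apply/eqP.
apply/forallP=> x; rewrite ffunE; case: (x \in A) => //.
by case: (f x) => //= z; case: ifP.
Qed.

Definition graft v D g h : {ffun T -> option T} :=
  [ffun x => if x == v then None else if x \in D then Some (odflt v (g x)) else h x].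

(** If predecessors of elements of A stay in A, then reaching an element of A
    depends only on the steps that end in A. *)
Lemma connect_agree (e e' : rel T) A :
  (forall x y, y \in A -> e x y = e' x y) ->
  (forall x y, y \in A -> e x y -> x \in A) ->
  forall j i, i \in A -> connect e j i = connect e' j i.
Proof.
move=> ee' eA j i iA.
apply/connectP/connectP=> -[p pP Ei]; exists p => //; subst i.
  suff /andP[] : (j \in A) && path e' j p by [].
  elim: p j iA pP => [|k p IHp] j /=; first by move->.
  move=> lA /andP[jk /(IHp k lA)/andP[kA ->]].
  by rewrite -(ee' _ _ kA) jk (eA _ _ kA jk).
suff /andP[] : (j \in A) && path e j p by [].
elim: p j iA pP => [|k p IHp] j /=; first by move->.
move=> lA /andP[jk /(IHp k lA)/andP[kA ->]].
by rewrite (ee' _ _ kA) jk (eA _ _ kA) ?ee'.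
Qed.

Definition root_of f x : T :=
  odflt x [pick r | (f r == None) && connect (parent f) x r].

Lemma root_of_eq f x r : acyclic_parent f ->
  (root_of f x == r) = (f r == None) && connect (parent f) x r.
Proof.
move=> acf; rewrite /root_of; case: pickP => [s /andP[/eqP fs xs]|no_root] /=.
  apply/eqP/idP => [<-|/andP[/eqP fr xr]]; first by rewrite fs xs.
  exact: connect_root_uniq xs xr.
have [s fs xs] := has_root x acf.
by have := no_root s; rewrite fs xs.
Qed.

Definition strict_desc f v : {set T} := [set x | (x != v) && connect (parent f) x v].

Lemma card_in_sum A (P : pred T) : #|[set i in A | P i]| = (\sum_(i in A) P i)%N.
Proof. by rewrite -sum1dep_card big_mkcondr; apply: eq_bigr => i _; case: (P i). Qed.

Section Graft.
Variables (S D : {set T}) (v : T) (g h : {ffun T -> option T}).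
Hypotheses (vS : v \in S) (DS : D \subset S :\ v).
Let R := S :\ v :\: D.
Hypotheses (gD : forest_on D g) (hR : forest_on R h).
Let f := graft v D g h.

Let vD : v \notin D.
Proof. by apply/negP=> /(subsetP DS); rewrite !inE eqxx. Qed.

Let fv : f v = None. Proof. by rewrite ffunE eqxx. Qed.

Let graft_D x : x \in D -> f x = Some (odflt v (g x)).
Proof. by move=> xD; rewrite ffunE xD; case: eqP xD => // ->; rewrite (negPf vD). Qed.

Let graft_R x : x \notin v |: D -> f x = h x.
Proof. by rewrite ffunE !inE negb_or => /andP[/negPf-> /negPf->]. Qed.

Let in_R x : x \in R -> x \notin v |: D.
Proof. by rewrite !inE negb_or => /and3P[-> -> _]. Qed.

Lemma graft_acyclic : acyclic_parent f.
Proof.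
case/andP: gD => /acyclic_rankP[dg dgP] _; case/andP: hR => /acyclic_rankP[dh dhP] _.
apply/acyclic_rankP.
exists (fun x => if x == v then 0 else if x \in D then (dg x).+1 else dh x)%N => x y.
rewrite /parent; case: (x =P v) => [->|/eqP nxv]; first by rewrite fv.
case: (boolP (x \in D)) => xD.
  rewrite graft_D // => /eqP[<-]; case E: (g x) => [z|] /=; last by rewrite eqxx.
  have /andP[_ zD] := forest_on_in gD E; rewrite zD.
  by case: ifP => // _; rewrite ltnS dgP //; apply/eqP.
rewrite graft_R ?inE ?negb_or ?nxv // => hxy.
have /andP[_ yR] := forest_on_in hR (eqP hxy).
have := in_R yR; rewrite !inE negb_or => /andP[/negPf-> /negPf->].
exact: dhP.
Qed.

Lemma graft_forest : forest_on S f.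
Proof.
rewrite /forest_on graft_acyclic; apply/forallP=> x.
have [xvD|/[dup] xvD /graft_R->] := boolP (x \in v |: D).
  have xS : x \in S.
    by case/setU1P: xvD => [->//|/(subsetP DS)]; rewrite inE => /andP[].
  rewrite xS; case/setU1P: xvD => [->|xD]; first by rewrite fv.
  rewrite graft_D //; case E: (g x) => [z|] //=.
  by have /andP[_ /(subsetP DS)] := forest_on_in gD E; rewrite inE => /andP[].
case: ifP => xS.
  case E: (h x) => [y|] //.
  by have /andP[_] := forest_on_in hR E; rewrite !inE => /and3P[].
by apply/eqP/(forest_on_out hR); rewrite !inE xS !andbF.
Qed.

(** So v |: D is a union of trees; by graft_desc it is the single tree of v. *)
Lemma graft_closed : closed (parent f) (mem (v |: D)).
Proof.
move=> x y fxy; rewrite !inE -!in_setU1; move: fxy; rewrite /parent.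
have [/setU1P[->|xD]|/[dup] xvD /graft_R-> /eqP hxy] := boolP (x \in v |: D).
- by rewrite fv.
- rewrite graft_D // => /eqP[<-]; case E: (g x) => [z|] /=; last by rewrite setU11.
  by have /andP[_ zD] := forest_on_in gD E; rewrite setU1r.
by have /andP[_ /in_R/negPf->] := forest_on_in hR hxy.
Qed.

Lemma graft_desc x : connect (parent f) x v = (x \in v |: D).
Proof.
apply/idP/idP=> [/(closed_connect graft_closed)|xvD].
  by rewrite !inE -!in_setU1 setU11.
have [r fr xr] := has_root x graft_acyclic.
have := closed_connect graft_closed xr; rewrite !inE -!in_setU1 xvD => /esym.
by case/setU1P=> [<-//|rD]; rewrite graft_D in fr.
Qed.

Lemma strict_desc_graft : strict_desc f v = D.
Proof.
apply/setP=> x; rewrite inE graft_desc !inE; case: eqP => [->|] //=.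
by rewrite (negPf vD).
Qed.

Lemma root_of_graft x : x \in v |: D -> root_of f x = v.
Proof.
by move=> xvD; apply/eqP; rewrite root_of_eq ?graft_acyclic // fv graft_desc.
Qed.

Lemma prune_graftD : prune D f = g.
Proof.
apply/ffunP=> x; rewrite ffunE; case: ifP => [xD|/negbT xD]; last first.
  by rewrite (forest_on_out gD).
rewrite graft_D //=; case E: (g x) => [z|] /=; last by rewrite (negPf vD).
by have /andP[_ ->] := forest_on_in gD E.
Qed.

Lemma prune_graftR : prune R f = h.
Proof.
apply/ffunP=> x; rewrite ffunE; case: ifP => [xR|/negbT xR]; last first.
  by rewrite (forest_on_out hR).
rewrite graft_R ?in_R //; case E: (h x) => [z|] //=.
by have /andP[_ ->] := forest_on_in hR E.
Qed.

Lemma connect_graftD j i : i \in D -> connect (parent f) j i = connect (parent g) j i.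
Proof.
have gP x y : y \in D -> parent f x y = parent g x y.
  move=> yD; rewrite /parent.
  have [/setU1P[->|xD]|/[dup] xvD /graft_R->] := boolP (x \in v |: D).
  - by rewrite fv (forest_on_out gD vD).
  - rewrite graft_D //; case: (g x) => [z|] //=.
    by apply: contraNF vD => /eqP[->].
  rewrite (forest_on_out gD); last by move: xvD; rewrite !inE negb_or => /andP[].
  apply: contraTF yD => /eqP/(forest_on_in hR)/andP[_ /in_R].
  by rewrite !inE negb_or => /andP[].
apply: connect_agree => // x y yD; rewrite gP // => /eqP/(forest_on_in gD).
by case/andP.
Qed.

Lemma connect_graftR j i : i \in R -> connect (parent f) j i = connect (parent h) j i.
Proof.
have hP x y : y \in R -> parent f x y = parent h x y.
  move=> yR; rewrite /parent.
  have [xvD|/graft_R-> //] := boolP (x \in v |: D).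
  rewrite (forest_on_out hR); last by apply: contraL xvD => /in_R.
  apply: contraTF yR => /[dup] fxy /eqP Exy.
  apply/negP=> /in_R; have := graft_closed fxy; rewrite !inE -!in_setU1 xvD.
  by move<-.
apply: connect_agree => // x y yR; rewrite hP // => /eqP/(forest_on_in hR).
by case/andP.
Qed.

(** Vertices of D and R keep their descendants; the minimum m descends from v,
    so that v is proper only if it is m. *)
Lemma card_proper_graft m : m \in v |: D -> (forall x, x \in S -> m <= x)%N ->
  #|[set i in S | min_proper f i]| =
  ((v == m) + (#|[set i in D | min_proper g i]| + #|[set i in R | min_proper h i]|))%N.
Proof.
move=> mvD min_m; rewrite !card_in_sum (big_setD1 v vS) /= (big_setID D) /=.
rewrite (setIidPr DS); congr (_ + (_ + _))%N; last 2 first.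
- apply: eq_bigr => i iD; congr nat_of_bool; apply: eq_forallb => j.
  by rewrite connect_graftD.
- apply: eq_bigr => i iR; congr nat_of_bool; apply: eq_forallb => j.
  by rewrite connect_graftR.
congr nat_of_bool; apply/forallP/eqP=> [/(_ m) | -> j].
  rewrite graft_desc mvD /= => le_vm; apply/val_inj/eqP.
  by rewrite eqn_leq le_vm min_m.
apply/implyP; case Ej: (f j) => [k|]; last first.
  by move/(connect_parent_None Ej)->.
by move=> _; apply: min_m; case/andP: (forest_on_in graft_forest Ej).
Qed.

End Graft.

Lemma graft_prune S f v : forest_on S f -> f v = None ->
  let D := strict_desc f v in
  graft v D (prune D f) (prune (S :\ v :\: D) f) = f.
Proof.
move=> fS fv /=; apply/ffunP=> x; rewrite !ffunE.
case: (x =P v) => [->|/eqP nxv] //.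
have stepv y : f x = Some y -> connect (parent f) y v -> connect (parent f) x v.
  by move=> fx; apply: connect_trans; apply/connect1/eqP.
case: (boolP (x \in strict_desc f v)) => xD.
  have /connectP[[|y p] /=] : connect (parent f) x v by move: xD; rewrite inE => /andP[].
    by move=> _ E; rewrite E eqxx in nxv.
  case/andP=> /eqP fx yp Ev; rewrite fx /= inE; case: (y =P v) => [->|_] //=.
  by rewrite (_ : connect _ _ _ = true) //; apply/connectP; exists p.
have nxv' : ~~ connect (parent f) x v by move: xD; rewrite inE nxv => /= ->.
rewrite in_setD xD /= !inE nxv /=.
case: ifP => [xS|/negbT xS]; last by rewrite (forest_on_out fS xS).
case E: (f x) => [y|] //=; rewrite 3!inE.
have /andP[_ ->] := forest_on_in fS E; rewrite andbT.
have nyv : y != v by apply: contraNneq nxv' => Ey; apply: connect1; rewrite /parent E Ey.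
by rewrite nyv inE nyv /= (contra (stepv _ E) nxv').
Qed.

(** The map graft v D is a bijection from pairs of forests on D and on the
    remaining vertices to the forests on S in which v is the root above m and
    D its set of strict descendants; its inverse is given by prune. *)
Lemma forest_weight_rec S m : m \in S -> (forall x, x \in S -> m <= x)%N ->
  forest_weight S = \sum_(v in S) \sum_(D : {set T} | (D \subset S :\ v) && (m \in v |: D))
               'X^(v == m) * (forest_weight D * forest_weight (S :\ v :\: D)).
Proof.
move=> mS min_m.
pose key f := (root_of f m, strict_desc f (root_of f m)).
pose Q (k : T * {set T}) := (k.1 \in S) && ((k.2 \subset S :\ k.1) && (m \in k.1 |: k.2)).
rewrite /forest_weight (partition_big key Q) /=; last first.
  move=> f fS; have acf : acyclic_parent f by case/andP: fS.
  have := root_of_eq m (root_of f m) acf; rewrite eqxx => /esym/andP[fr mr].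
  (* a vertex with a parent is in S, and x has one if it is not the root *)
  have in_S x : connect (parent f) x (root_of f m) -> x != root_of f m -> x \in S.
    move=> xr nxr; case E: (f x) => [y|]; first by case/andP: (forest_on_in fS E).
    by rewrite (connect_parent_None E xr) eqxx in nxr.
  rewrite /Q /=; apply/and3P; split.
  - case/connectP: mr => p; elim/last_ind: p => [|p y _] /=; first by move=> _ ->.
    rewrite rcons_path last_rcons => /andP[_ /eqP ly] ->.
    by case/andP: (forest_on_in fS ly).
  - by apply/subsetP=> x; rewrite inE => /andP[nxr xr]; rewrite !inE nxr in_S.
  by rewrite !inE mr andbT orbN.
rewrite [RHS]pair_big_dep /=; apply: eq_bigr => -[v D] /= /and3P[vS DS mvD].
set R := S :\ v :\: D.
rewrite (reindex_onto (fun k => graft v D k.1 k.2) (fun f => (prune D f, prune R f))) /=; last first.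
  move=> f /andP[fS]; rewrite /R => /eqP[<- <-]; apply: graft_prune => //.
  have acf : acyclic_parent f by case/andP: fS.
  by have := root_of_eq m (root_of f m) acf; rewrite eqxx => /esym/andP[/eqP].
rewrite (eq_bigl (fun k => forest_on D k.1 && forest_on R k.2)); last first.
  case=> g h /=; apply/idP/idP=> [/andP[/andP[/andP[acf _] _] /eqP[Eg Eh]]|/andP[gD hR]].
    by apply/andP; split; [rewrite -Eg | rewrite -Eh]; apply: prune_forest.
  rewrite (graft_forest vS DS gD hR) /key (root_of_graft DS gD hR mvD).
  rewrite (strict_desc_graft DS gD hR).
  by rewrite (prune_graftD h DS gD) (prune_graftR g hR) !eqxx.
rewrite big_distrlr pair_big /= mulr_sumr.
apply: eq_big => [[g h]|[g h] /andP[gD hR]] //=.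
by rewrite (card_proper_graft vS DS gD hR mvD min_m) !exprD.
Qed.

Lemma forest_weight_set0 : forest_weight set0 = 1.
Proof.
rewrite /forest_weight (big_pred1 [ffun=> None]) /=.
  by rewrite (_ : [set i in set0 | _] = set0) ?cards0 //; apply/setP=> x; rewrite !inE.
move=> f; apply/idP/eqP=> [fS | ->].
  by apply/ffunP=> x; rewrite ffunE (forest_on_out fS) ?inE.
apply/andP; split; last by apply/forallP=> x; rewrite ffunE inE.
by apply/acyclic_rankP; exists (fun=> 0)%N => x y; rewrite /parent ffunE.
Qed.

Lemma forest_weight_setT : forest_weight [set: T] = forest_poly N.
Proof.
rewrite forest_poly_sum_parent; apply: eq_big => [f|f _].
  rewrite /forest_on andbC; case: forallP => // -[] x; rewrite inE.
  by case: (f x) => // y; rewrite inE.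
by congr ('X^ _); apply: eq_card => i; rewrite !inE.
Qed.

End Recursion.

Lemma sum_subsets_card (T : finType) (V : pzSemiRingType) (A : {set T}) (F : nat -> V) :
  \sum_(D : {set T} | D \subset A) F #|D| =
  \sum_(k < #|A|.+1) 'C(#|A|, k)%:R * F k.
Proof.
rewrite (partition_big (fun D : {set T} => inord #|D| : 'I_#|A|.+1) xpredT) //=.
apply: eq_bigr => k _.
rewrite (eq_bigl (mem [set B : {set T} | B \subset A & #|B| == k])); last first.
  move=> D /=; rewrite inE; apply: andb_id2l => DA.
  by rewrite -val_eqE /= inordK // ltnS subset_leq_card.
rewrite (eq_bigr (fun=> F k)); last by move=> D /=; rewrite inE => /andP[_ /eqP->].
by rewrite sumr_const cards_draws mulr_natl.
Qed.

(** Complementation in A exchanges the subsets with and without m. *)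
Lemma sum_subsets_half (T : finType) (V : comPzRingType) (A : {set T}) (m : T) (F : nat -> V) :
  m \in A ->
  2%:R * \sum_(D : {set T} | (D \subset A) && (m \in D)) F #|D| * F #|A :\: D| =
  \sum_(D : {set T} | D \subset A) F #|D| * F #|A :\: D|.
Proof.
move=> mA; rewrite mulr_natl mulr2n [RHS](bigID (fun D : {set T} => m \in D)) /=.
congr (_ + _).
rewrite (reindex_onto (fun D => A :\: D) (fun D => A :\: D)) /=; last first.
  by move=> D /andP[DA _]; rewrite setDDr setDv set0U; apply/setIidPr.
apply: eq_big => [D|D /andP[_ /eqP->]]; last by rewrite mulrC.
rewrite subsetDl inE mA andbT /= andbC; apply: andb_id2r => _.
apply/eqP/idP => [<-|DA]; first exact: subsetDl.
by rewrite setDDr setDv set0U; apply/setIidPr.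
Qed.

(** Since forest_weight_rec expresses the weight of S by the weights of smaller
    subsets, induction on the cardinal also shows that it depends on S only
    through its cardinal. *)
Lemma forest_weightE N (S : {set 'I_N}) : forest_weight S = product_poly #|S|.
Proof.
have [n] := ubnP #|S|; elim: n S => // n IHn S lt_Sn.
have [->|[m0 m0S]] := set_0Vmem S; first by rewrite forest_weight_set0 cards0.
have [m mS min_m] := arg_minnP (fun x : 'I_N => x : nat) m0S.
pose P D := product_poly #|D : {set 'I_N}|.
have SvE v : v \in S -> #|S| = #|S :\ v|.+1 by move=> vS; rewrite (cardsD1 v) vS.
have sumE v : v \in S ->
    2%:R * \sum_(D : {set 'I_N} | (D \subset S :\ v) && (m \in v |: D))
      'X^(v == m) * (forest_weight D * forest_weight (S :\ v :\: D)) =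
    (if v == m then 2%:R * 'X else 1) *
      \sum_(k < #|S|) 'C(#|S|.-1, k)%:R * (product_poly k * product_poly (#|S|.-1 - k)).
  move=> vS; rewrite (SvE v vS) /=.
  rewrite (eq_bigr (fun D => 'X^(v == m) * (P D * P (S :\ v :\: D)))); last first.
    have lt_n (A : {set 'I_N}) : A \subset S :\ v -> (#|A| < n)%N.
      by move=> AS; apply: leq_ltn_trans (subset_leq_card AS) _; rewrite -ltnS -SvE.
    by move=> D /andP[DS _]; rewrite !IHn ?lt_n // subsetDl.
  rewrite -(sum_subsets_card (S :\ v) (fun k => product_poly k * product_poly (_ - k))).
  have -> : \sum_(D : {set 'I_N} | D \subset S :\ v)
              product_poly #|D| * product_poly (#|S :\ v| - #|D|) =
            \sum_(D : {set 'I_N} | D \subset S :\ v) P D * P (S :\ v :\: D).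
    by apply: eq_bigr => D DS; rewrite /P [in RHS]cardsDS.
  case: (v =P m) => [->|/eqP nvm].
    rewrite -mulr_sumr mulrA; congr (_ * _); apply: eq_bigl => D.
    by rewrite setU11 andbT.
  rewrite mul1r -(@sum_subsets_half _ _ _ m); last by rewrite !inE eq_sym nvm.
  congr (_ * _); apply: eq_big => [D|D _]; last by rewrite mul1r.
  by rewrite !inE eq_sym (negPf nvm).
have two0 : 2%:R != 0 :> {poly rat} := natpoly_neq0 1.
apply: (mulfI two0); rewrite (forest_weight_rec mS min_m) mulr_sumr (eq_bigr _ sumE).
rewrite -mulr_suml (SvE m mS) product_poly_rec; congr (_ * _).
rewrite (big_setD1 m) //= eqxx; congr (_ + _).
rewrite (eq_bigr (fun=> 1)) ?sumr_const //.
by move=> v; rewrite !inE => /andP[/negPf->].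
Qed.

Theorem forest_polyE n : forest_poly n = product_poly n.
Proof. by rewrite -forest_weight_setT forest_weightE cardsT card_ord. Qed.

(** * Power series modulo powers of X *)

Section Truncation.
Variable K : fieldType.
Implicit Types (a b u : nat -> K) (p q r : {poly K}) (c : K).

(** Polynomials with the same first n coefficients stand for power series, so
    that the ring structure and the derivation of polynomials can be used. *)
Definition agrees n p a := forall i, (i < n)%N -> p`_i = a i.

Definition trunc n a : {poly K} := \poly_(i < n) a i.

Lemma trunc_agrees n a : agrees n (trunc n a) a.
Proof. by move=> i lt_in; rewrite coef_poly lt_in. Qed.

Lemma agrees_mul n p q a b :
  agrees n p a -> agrees n q b -> agrees n (p * q) (fps_mul a b).
Proof.
move=> pa qb i lt_in; rewrite coefM /fps_mul; apply: eq_bigr => j _.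
rewrite pa ?qb // ?(leq_ltn_trans _ lt_in) ?leq_subr //.
by rewrite -ltnS.
Qed.

Lemma agrees_pow n p a k : agrees n p a -> agrees n (p ^+ k) (fps_pow a k).
Proof.
move=> pa; elim: k => [|k IHk]; first by move=> i _; rewrite expr0 coef1.
by rewrite exprS; apply: agrees_mul.
Qed.

Lemma agrees_X n : agrees n 'X fps_X.
Proof. by move=> i _; rewrite coefX. Qed.

Lemma agrees_deriv n p a : agrees n.+1 p a -> agrees n p^`() (fps_deriv a).
Proof. by move=> pa i lt_in; rewrite coef_deriv pa // /fps_deriv mulr_natl. Qed.

Lemma dvdXnP n p : reflect (forall i, (i < n)%N -> p`_i = 0) ('X^n %| p).
Proof.
apply: (iffP idP) => [/Pdiv.Field.dvdpP[q ->] i lt_in|p0]; first by rewrite coefMXn lt_in.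
rewrite -[p](poly_take_drop n) (_ : take_poly n p = 0) ?add0r ?dvdp_mull //.
by apply/polyP => i; rewrite coef_take_poly coef0; case: ifP => // /p0.
Qed.

(** * The binomial series and its linear differential equation *)

Hypothesis char0 : forall k, k.+1%:R != 0 :> K.

Lemma gbinomS c j : j.+1%:R * gbinom c j.+1 = (c - j%:R) * gbinom c j.
Proof.
rewrite /gbinom big_ord_recr factS natrM /=.
have f0 : j`!%:R != 0 :> K by rewrite -(prednK (fact_gt0 j)) char0.
have := char0 j; move: j.+1%:R => S S0; by field; rewrite f0 S0.
Qed.

(** The partial sum h of (1 + u)^c satisfies (1 + u) h' = c h u' up to one term;
    the contributions of consecutive summands cancel by gbinomS. *)
Lemma binpow_ode c (u : {poly K}) n :
  let h := \sum_(j < n.+1) gbinom c j *: u ^+ j in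
  (1 + u) * h^`() - c *: (h * u^`()) =
    - ((n.+1%:R * gbinom c n.+1) *: (u ^+ n * u^`())).
Proof.
elim: n => [|n IHn] /=.
  rewrite big_ord1 linearZ /= expr0 derivC scaler0 mulr0 sub0r gbinomS subr0.
  by rewrite -!scalerAl scalerA.
rewrite big_ord_recr /= linearD /= mulrDr [X in c *: X]mulrDl scalerDr opprD addrACA {}IHn.
rewrite derivZ deriv_exp /= [n.+2%:R * _]gbinomS.
move: (gbinom c n.+1) => g.
by rewrite -!mul_polyC !polyCM polyCB !polyC_natr -mulr_natr exprS; ring.
Qed.

(** As u has no constant term, the coefficient of degree n of the equation for
    the difference z involves only n.+1%:R * z`_n.+1 besides coefficients of z
    of smaller index. *)
Lemma linear_ode_uniq c n (u p q : {poly K}) : u`_0 = 0 -> p`_0 = q`_0 ->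
  'X^n %| ((1 + u) * p^`() - c *: (p * u^`())) ->
  'X^n %| ((1 + u) * q^`() - c *: (q * u^`())) ->
  'X^(n.+1) %| (p - q).
Proof.
move=> u0 pq0 odep odeq; set z := p - q.
have z0 : z`_0 = 0 by rewrite coefB pq0 subrr.
have {odep odeq} : 'X^n %| ((1 + u) * z^`() - c *: (z * u^`())).
  have := dvdp_sub odep odeq; congr (_ %| _).
  by rewrite /z derivB -!mul_polyC; ring.
elim: n => [|n IHn] ode.
  by apply/dvdXnP => -[|//] _.
have {IHn} /IHn dvd_z : 'X^n %| ((1 + u) * z^`() - c *: (z * u^`())).
  by apply: dvdp_trans ode; rewrite dvdp_exp2l.
apply/dvdXnP=> i; rewrite ltnS leq_eqVlt => /orP[/eqP->|]; last exact/dvdXnP.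
have X_u : 'X %| u by rewrite -['X]expr1; apply/dvdXnP => -[].
have Xn_z' : 'X^n %| z^`().
  apply/dvdXnP=> k lt_kn; rewrite coef_deriv.
  by have /dvdXnP-> := dvd_z; rewrite ?mul0rn.
have /dvdXnP/(_ n (ltnSn n)) uz' : 'X^(n.+1) %| u * z^`() by rewrite exprS dvdp_mul.
have /dvdXnP/(_ n (ltnSn n)) zu' : 'X^(n.+1) %| z * u^`() by rewrite dvdp_mulr.
have /dvdXnP/(_ n (ltnSn n)) := ode.
rewrite coefB coefZ zu' mulr0 subr0 mulrDl mul1r coefD uz' addr0 coef_deriv -mulr_natr.
by move/eqP; rewrite mulf_eq0 (negPf (char0 n)) orbF => /eqP.
Qed.
End Truncation.

(** * From the recurrence to the differential and functional equations *)

Section Series.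
Variable K : fieldType.
Implicit Types (a b F : nat -> K).
Hypothesis char0 : forall k, k.+1%:R != 0 :> K.

Lemma fps_mul_Xl a n : fps_mul fps_X a n = if n is m.+1 then a m else 0.
Proof.
case: n => [|n]; first by rewrite /fps_mul big_ord1 mul0r.
rewrite /fps_mul big_ord_recl big_ord_recl big1 => [|i _]; last by rewrite mul0r.
by rewrite mul0r mul1r add0r addr0 /= subSS subn0.
Qed.

Lemma fps_pow2 a : fps_pow a 2 =1 fps_mul a a.
Proof.
move=> n; apply: eq_bigr => i _; congr (_ * _).
rewrite /fps_pow /= /fps_mul big_ord_recr big1 => [|j _] /=.
  by rewrite subnn /fps_one eqxx mulr1 add0r.
by rewrite /fps_one subn_eq0 leqNgt ltn_ord mulr0.
Qed.

(** 2 F F' = (F^2)', by pairing each term with its mirror image. *)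
Lemma fps_mul_deriv a n :
  2%:R * fps_mul a (fps_deriv a) n = n.+1%:R * fps_mul a a n.+1.
Proof.
have -> : fps_mul a (fps_deriv a) n =
          \sum_(k < n.+2) (n.+1 - k)%N%:R * (a k * a (n.+1 - k)%N).
  rewrite big_ord_recr /= subnn mul0r addr0; apply: eq_bigr => k _.
  by rewrite /fps_deriv subSn -1?ltnS //; ring.
rewrite mulr_natl mulr2n {2}(reindex_inj rev_ord_inj) /= -big_split mulr_sumr.
apply: eq_bigr => k _ /=.
rewrite subSS subKn -1?ltnS // natrB -1?ltnS //; ring.
Qed.

Lemma egf_mul (a b : nat -> K) n :
  fps_mul (fun k => a k / k`!%:R) (fun k => b k / k`!%:R) n =
  (\sum_(k < n.+1) 'C(n, k)%:R * (a k * b (n - k)%N)) / n`!%:R.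
Proof.
have nat0 m : (0 < m)%N -> m%:R != 0 :> K by case: m.
rewrite mulr_suml; apply: eq_bigr => k _.
have kn : (k <= n)%N by rewrite -ltnS.
rewrite -(bin_fact kn) !natrM.
have := nat0 _ (fact_gt0 k); have := nat0 _ (fact_gt0 (n - k)).
have : 'C(n, k)%:R != 0 :> K by rewrite nat0 // bin_gt0.
move: 'C(n, k)%:R (k`!)%:R (n - k)`!%:R => x y w x0 w0 y0.
by field; rewrite x0 y0 w0.
Qed.

Lemma egf_rec (t : K) (a : nat -> K) n :
  2%:R * a n.+1 = (2%:R * t + n%:R) *
    \sum_(k < n.+1) 'C(n, k)%:R * (a k * a (n - k)%N) ->
  let F k := a k / k`!%:R in
  2%:R * n.+1%:R * F n.+1 = (2%:R * t + n%:R) * fps_mul F F n.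
Proof.
move=> rec_a F; rewrite egf_mul mulrA -rec_a /F factS natrM.
have f0 : n`!%:R != 0 :> K by rewrite -(prednK (fact_gt0 n)) char0.
have := char0 n; move: n.+1%:R => S S0.
by field; rewrite S0 f0.
Qed.

Lemma ode_of_rec (t : K) F :
  (forall n, 2%:R * n.+1%:R * F n.+1 = (2%:R * t + n%:R) * fps_mul F F n) ->
  fps_deriv F =1 fps_add (fps_mul fps_X (fps_mul F (fps_deriv F)))
                         (fps_scale t (fps_pow F 2)).
Proof.
move=> recF n; apply: (mulfI (char0 1)).
rewrite /fps_deriv mulrA recF /fps_add /fps_scale fps_pow2 fps_mul_Xl.
rewrite mulrDr -/(fps_deriv F); case: n => [|n]; first ring.
by rewrite [in RHS]fps_mul_deriv; ring.
Qed.

(** Both sides solve (1 + u) y' = c y u' with constant term 1, where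
    u = (t - 1) x F and c = t / (t - 1). *)
Lemma binpow_of_ode (t : K) F : t - 1 != 0 -> F 0%N = 1 ->
  fps_deriv F =1 fps_add (fps_mul fps_X (fps_mul F (fps_deriv F)))
                         (fps_scale t (fps_pow F 2)) ->
  F =1 fps_binpow (fps_scale (t - 1) (fps_mul fps_X F)) (t / (t - 1)).
Proof.
move=> t1 F0 odeF n; set c := t / (t - 1).
pose p := trunc n.+1 F; have pF : agrees n.+1 p F by apply: trunc_agrees.
pose u : {poly K} := (t - 1) *: ('X * p).
have uF : agrees n.+1 u (fps_scale (t - 1) (fps_mul fps_X F)).
  by move=> i lt_in; rewrite coefZ (agrees_mul (@agrees_X _ n.+1) pF).
pose h : {poly K} := \sum_(j < n.+1) gbinom c j *: u ^+ j.
have u0 : u`_0 = 0 by rewrite coefZ coefXM mulr0.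
have h0 : h`_0 = 1.
  rewrite coef_sum big_ord_recl big1 => [|j _].
    by rewrite coefZ expr0 coef1 /gbinom big_ord0 fact0 divr1 mulr1 addr0.
  by rewrite coefZ exprS -horner_coef0 hornerM horner_coef0 u0 mul0r mulr0.
suff /dvdXnP/(_ n (ltnSn n))/eqP : 'X^(n.+1) %| p - h.
  rewrite coefB subr_eq0 pF // => /eqP->; rewrite coef_sum; apply: eq_bigr => j _.
  by rewrite coefZ (agrees_pow j uF).
apply: (linear_ode_uniq char0 (c := c) (u := u)) => //; last 2 first.
- (* the linear equation for F is the given nonlinear one, rearranged *)
  rewrite (_ : _ - _ = p^`() - ('X * (p * p^`()) + t *: (p ^+ 2))); last first.
    rewrite /u derivZ derivM derivX /c -!mul_polyC polyCM.
    have E : (t - 1)%:P * ((t - 1)^-1)%:P = 1 :> {poly K} by rewrite -polyCM divff.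
    rewrite polyCB polyC1 in E *.
    rewrite [t%:P * _ * _](_ : _ = t%:P * ((t%:P - 1) * ((t - 1)^-1)%:P) *
      (p * (1 * p + 'X * p^`()))); last by ring.
    by rewrite E; ring.
  apply/dvdXnP=> i lt_in; rewrite coefB (agrees_deriv pF) // odeF coefD coefZ.
  have pF' : agrees n p F by move=> j lt_jn; rewrite pF // ltnW.
  rewrite /fps_add /fps_scale (agrees_pow 2 pF') //.
  rewrite (agrees_mul (@agrees_X _ n) (agrees_mul pF' (agrees_deriv pF))) //.
  by rewrite subrr.
- rewrite /h binpow_ode // dvdpNr -mul_polyC dvdp_mull // dvdp_mulr //.
  by rewrite /u scalerAr dvdp_exp2r // dvdp_mulr.
- by rewrite h0 pF.
Qed.
End Series.

(** * The series of rooted forests *)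

Lemma Qt_nat_neq0 k : k.+1%:R != 0 :> Qt.
Proof. by rewrite -(rmorph_nat (@tofrac _)) tofrac_eq0 natpoly_neq0. Qed.

Lemma forest_series_rec n :
  2%:R * n.+1%:R * forest_series n.+1 =
  (2%:R * tvar + n%:R) * fps_mul forest_series forest_series n.
Proof.
apply: (egf_rec Qt_nat_neq0 (a := fun k => tofrac (forest_poly k))).
rewrite forest_polyE -(rmorph_nat (@tofrac _) 2) -(rmorph_nat (@tofrac _) n) /tvar.
rewrite -!rmorphM -rmorphD product_poly_rec rmorphM rmorph_sum; congr (_ * _).
by apply: eq_bigr => k _; rewrite !forest_polyE !rmorphM rmorph_nat.
Qed.

Theorem theorem7 :
  [/\ fps_deriv forest_series =1
        fps_add
          (fps_mul fps_X (fps_mul forest_series (fps_deriv forest_series)))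
          (fps_scale tvar (fps_pow forest_series 2))
      /\ forest_series 0%N = 1,
      forest_series =1
        fps_binpow (fps_scale (tvar - 1) (fps_mul fps_X forest_series))
                   (tvar / (tvar - 1))
    & forall n : nat, (1 <= n)%N ->
        forest_poly n =
          'X * \prod_(1 <= i < n) ((i + 1)%N%:R * 'X + (n - i)%N%:R)].
Proof.
have ode := ode_of_rec Qt_nat_neq0 forest_series_rec.
have F0 : forest_series 0%N = 1.
  by rewrite /forest_series forest_polyE rmorph1 fact0 divr1.
split=> // [|[|n] // _]; last by rewrite forest_polyE.
apply: binpow_of_ode ode => //; first exact: Qt_nat_neq0.
by rewrite /tvar -(rmorph1 (@tofrac _)) -rmorphB tofrac_eq0 polyXsubC_eq0.
Qed.
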